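(* Let $(v,R)$ be a smooth solution to the Lagrangian compressible free-boundary Euler system (L) (written out in the context) defined on $[0,T)$, with flow map $\eta$. Then $$\varepsilon^{\alpha\beta\gamma}\,\partial_\beta v^\mu\,\partial_\gamma\eta_\mu=\omega_0^\alpha\qquad(\alpha=1,2,3)$$ in $\Omega$ for $0\le t<T$, where $\varepsilon^{\alpha\beta\gamma}$ is the totally anti-symmetric symbol with $\varepsilon^{123}=1$ and $\omega_0$ is the vorticity at time zero, $\omega_0=\operatorname{curl}v_0$, i.e. $\omega_0^\alpha=\varepsilon^{\alpha\beta\gamma}\partial_\beta v_{0\gamma}$.
   Context: Domain: $\Omega=\mathbb T^2\times(0,1)$ with coordinates $(x^1,x^2,x^3)$, $\Gamma_1=\mathbb T^2\times\{x^3=1\}$, $\Gamma_0=\mathbb T^2\times\{x^3=0\}$; $N$ is the unit outer normal to $\partial\Omega=\Gamma_0\cup\Gamma_1$. Indices: Greek indices range over $1,2,3$, Latin indices over $1,2$; repeated indices are summed; indices are raised and lowered with the Euclidean metric; $\partial_\alpha=\partial/\partial x^\alpha$. Standing assumptions: $\sigma>0$; $v_0$ is a smooth vector field on $\Omega$; $\varrho_0$ is a smooth positive function on $\Omega$ bounded away from zero; $q\colon(0,\infty)\to(0,\infty)$ is smooth and there is $A_q>0$ such that $q'(R)\ge A_q$ and $(q(R)/R)'\ge A_q$ for $R$ in a neighborhood of $\varrho_0$. System (L). The unknowns are the Lagrangian velocity $v$ and the Lagrangian density $R$; the flow map $\eta$ is defined by $\partial_t\eta=v$, $\eta(0,\cdot)=\mathrm{id}$;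 $a=(\nabla\eta)^{-1}$, i.e. $a^{\lambda\mu}\partial_\gamma\eta_\mu=\delta^\lambda_\gamma$; $q=q(R)$. The system is $$R\,\partial_tv^\alpha+a^{\mu\alpha}\partial_\mu q=0,\quad \partial_tR+R\,a^{\mu\alpha}\partial_\mu v_\alpha=0,\quad \partial_ta^{\alpha\beta}+a^{\alpha\gamma}\partial_\mu v_\gamma a^{\mu\beta}=0,\quad q=q(R)\ \text{ in }[0,T)\times\Omega,$$ $$a^{\mu\alpha}N_\mu q+\sigma|a^TN|\Delta_g\eta^\alpha=0\ \text{ on }[0,T)\times\Gamma_1,\qquad v^\mu N_\mu=0\ \text{ on }[0,T)\times\Gamma_0,$$ $$\eta(0,\cdot)=\mathrm{id},\quad R(0,\cdot)=\varrho_0,\quad v(0,\cdot)=v_0.$$ Here $(a^TN)^\alpha=a^{\mu\alpha}N_\mu$, and $\Delta_gf=\frac1{\sqrt g}\partial_i(\sqrt g\,g^{ij}\partial_jf)$ with $g_{ij}=\partial_i\eta^\mu\partial_j\eta_\mu$, $g=\det(g_{ij})$, $(g^{ij})=(g_{ij})^{-1}$. *)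

(* Defs.v *)
(* MathComp-Analysis, over an arbitrary R : realType. *)
From HB Require Import structures.
From mathcomp Require Import all_boot all_order all_algebra.
From mathcomp Require Import all_classical all_reals all_analysis.

Set Implicit Arguments.
Unset Strict Implicit.
Unset Printing Implicit Defensive.

Import Order.TTheory GRing.Theory Num.Theory.
Import numFieldNormedType.Exports.

Local Open Scope classical_set_scope.
Local Open Scope ring_scope.

(* [0, T) x (closure of Omega) is not open in space-time, so derivatives are
   taken relative to a set E: the increments h are those keeping the displaced
   point in E. This gives the two-sided derivative at interior points and the
   one-sided one at t = 0 and, in the direction x^3, on the boundary. *)

Definition diffq {R : realType} {V : normedModType R} (f : V -> R) (v p : V)
  : R -> R := fun h => h^-1 * (f (h *: v + p) - f p).

Definition incr_in {R : realType} {V : normedModType R} (E : set V) (v p : V)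
  : set_system R := within [set h | E (h *: v + p)] 0^'.

Definition deriv_in {R : realType} {V : normedModType R} (E : set V) (v : V)
    (f : V -> R) : V -> R :=
  fun p => lim (diffq f v p @ incr_in E v p).

(* C^oo on E: all iterated partial derivatives in the coordinate directions
   e i, relative to E, exist at every point of E and are continuous on E. *)
Definition smooth_in {R : realType} {V : normedModType R} {I : Type}
    (e : I -> V) (E : set V) (f : V -> R) : Prop :=
  forall s : seq I,
    let g := foldr (fun i => deriv_in E (e i)) f s in
    {within E, continuous g} /\
    (forall i p, E p -> cvg (diffq g (e i) p @ incr_in E (e i) p)).

Lemma deriv_in_open {R : realType} {V : normedModType R} (E : set V) (v : V)
    (f : V -> R) (p : V) : open E -> E p -> deriv_in E v f p = 'D_v f p.
Proof.
move=> oE Ep; rewrite /deriv_in /derive /incr_in.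
suff -> : within [set h : R | E (h *: v + p)] 0^' = 0^' by [].
have nE : \forall h \near (0:R)^', E (h *: v + p).
  apply: nbhs_dnbhs.
  have : (fun h : R => h *: v + p) @ (0 : R) --> (0 : R) *: v + p.
    by apply: cvgD; [apply: cvgZr_tmp|]; apply: cvg_cst || exact: cvg_id.
  by rewrite scale0r add0r; apply; exact: open_nbhs_nbhs.
apply/seteqP; split => A; rewrite /within /=.
  by move=> wA; near=> h; apply: (near wA h) => //=; near: h.
by move=> nA; near=> h => _; near: h.
Unshelve. all: by end_near. Qed.

(* Indices: x^1, x^2, x^3 are the coordinates 0, 1, 2 : 'I_3; the tangential
   (Latin) indices are the i : 'I_2, embedded in 'I_3 by tang. *)
Definition x1 : 'I_3 := inord 0.
Definition x2 : 'I_3 := inord 1.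
Definition x3 : 'I_3 := inord 2.
Definition tang (i : 'I_2) : 'I_3 := widen_ord (leqnSn 2) i.

Definition ebase {R : realType} (i : 'I_3) : 'rV[R]_3 := delta_mx 0 i.

(* Space-time is R * R^3; None is the time direction. *)
Definition ebase_st {R : realType} (o : option 'I_3) : (R * 'rV[R]_3)%type :=
  if o is Some i then (0, ebase i) else (1, 0).

Definition cpt {R : realType} {A : Type} (f : A -> 'rV[R]_3) (i : 'I_3)
  : A -> R := fun p => f p 0 i.

(* Omega is handled through its universal cover R^2 x (0, 1): functions on
   Omega are functions of x in R^3 that are 1-periodic in x^1 and x^2. *)
Definition Omega {R : realType} : set 'rV[R]_3 :=
  [set x | 0 < x 0 x3 < 1].
Definition Omegac {R : realType} : set 'rV[R]_3 :=
  [set x | 0 <= x 0 x3 <= 1].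
Definition Gamma0 {R : realType} : set 'rV[R]_3 := [set x | x 0 x3 = 0].
Definition Gamma1 {R : realType} : set 'rV[R]_3 := [set x | x 0 x3 = 1].

Definition cyl {R : realType} (T : R) (A : set 'rV[R]_3)
  : set (R * 'rV[R]_3)%type := [set p | 0 <= p.1 < T /\ A p.2].

Definition periodic_x {R : realType} {W : Type} (A : set 'rV[R]_3)
    (f : 'rV[R]_3 -> W) : Prop :=
  forall x, A x -> f (x + ebase x1) = f x /\ f (x + ebase x2) = f x.

Definition outer_normal {R : realType} (x : 'rV[R]_3) : 'rV[R]_3 :=
  if x 0 x3 == 1 then ebase x3 else - ebase x3.

(* The sign is given by the parity of the number of inversions of (a, b, c). *)
Definition levi_civita {R : realType} (a b c : 'I_3) : R :=
  if uniq [:: a; b; c] then (-1) ^+ ((b < a) + (c < a) + (c < b))%N else 0.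

Lemma levi_civita123 {R : realType} : levi_civita x1 x2 x3 = 1 :> R.
Proof.
by rewrite /levi_civita /= !inE -!val_eqE /= !inordK.
Qed.

Lemma levi_civita_anti12 {R : realType} (a b c : 'I_3) :
  levi_civita b a c = - levi_civita a b c :> R.
Proof.
rewrite /levi_civita /= !inE -!val_eqE /=.
case: a b c => [[|[|[|//]]] ?] [[|[|[|//]]] ?] [[|[|[|//]]] ?] /=;
  by rewrite ?(oppr0, expr0, expr1, expr2, exprS, mulr1, mulrNN, mulN1r, opprK).
Qed.

Lemma levi_civita_anti23 {R : realType} (a b c : 'I_3) :
  levi_civita a c b = - levi_civita a b c :> R.
Proof.
rewrite /levi_civita /= !inE -!val_eqE /=.
case: a b c => [[|[|[|//]]] ?] [[|[|[|//]]] ?] [[|[|[|//]]] ?] /=;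
  by rewrite ?(oppr0, expr0, expr1, expr2, exprS, mulr1, mulrNN, mulN1r, opprK).
Qed.

Definition curl {R : realType} (u : 'rV[R]_3 -> 'rV[R]_3) (x : 'rV[R]_3)
    (al : 'I_3) : R :=
  \sum_(be < 3) \sum_(ga < 3)
    levi_civita al be ga * deriv_in Omega (ebase be) (cpt u ga) x.

Section Lagrangian.
Context {R : realType} (T : R).
Local Notation spacetime := (R * 'rV[R]_3)%type.
Local Notation E := (cyl T Omegac).

Definition dt (f : spacetime -> R) : spacetime -> R :=
  deriv_in E (ebase_st None) f.
Definition dx (i : 'I_3) (f : spacetime -> R) : spacetime -> R :=
  deriv_in E (ebase_st (Some i)) f.

Definition smooth_st (f : spacetime -> R) : Prop := smooth_in ebase_st E f.

(* d_t eta = v and eta(0, .) = id, for the lift of the flow map to the universal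
   cover. *)
Definition is_flow_map (v eta : spacetime -> 'rV[R]_3) : Prop :=
  (forall x, Omegac x -> eta (0, x) = x) /\
  (forall p al, E p ->
     diffq (cpt eta al) (ebase_st None) p @ incr_in E (ebase_st None) p
       --> cpt v al p).

(* grad_flow eta p mu ga = d_ga eta_mu *)
Definition grad_flow (eta : spacetime -> 'rV[R]_3) (p : spacetime)
  : 'M[R]_3 := \matrix_(mu, ga) dx ga (cpt eta mu) p.

(* inv_flow eta p la mu = a^{la mu}; the system requires grad_flow eta p to be
   invertible, so the junk value of invmx plays no role. *)
Definition inv_flow (eta : spacetime -> 'rV[R]_3) (p : spacetime) : 'M[R]_3 :=
  invmx (grad_flow eta p).

Definition aentry (eta : spacetime -> 'rV[R]_3) (la mu : 'I_3)
  : spacetime -> R := fun p => inv_flow eta p la mu.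

(* (a^T N)^al = a^{mu al} N_mu *)
Definition aTN (eta : spacetime -> 'rV[R]_3) (p : spacetime) (al : 'I_3) : R :=
  \sum_(mu < 3) aentry eta mu al p * outer_normal p.2 0 mu.

Definition norm_aTN (eta : spacetime -> 'rV[R]_3) (p : spacetime) : R :=
  Num.sqrt (\sum_(al < 3) aTN eta p al ^+ 2).

Definition metric (eta : spacetime -> 'rV[R]_3) (p : spacetime) : 'M[R]_2 :=
  \matrix_(i, j) \sum_(mu < 3)
     dx (tang i) (cpt eta mu) p * dx (tang j) (cpt eta mu) p.

Definition sqrtg (eta : spacetime -> 'rV[R]_3) (p : spacetime) : R :=
  Num.sqrt (\det (metric eta p)).

Definition laplace_g (eta : spacetime -> 'rV[R]_3) (f : spacetime -> R)
    (p : spacetime) : R :=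
  (sqrtg eta p)^-1 *
  \sum_(i < 2) dx (tang i)
    (fun p' => \sum_(j < 2)
       sqrtg eta p' * invmx (metric eta p') i j * dx (tang j) f p') p.

(* q is real-valued: at t = 0 the surface Gamma_1 is flat, so the boundary
   condition forces q(rho0) = 0 there, and q > 0 would be inconsistent. *)
Record equation_of_state (q : R -> R) (rho0 : 'rV[R]_3 -> R) : Prop := {
  eos_smooth : forall n r, 0 < r -> derivable (derive1n n q) r 1;
  eos_mono : exists Aq : R, 0 < Aq /\
    exists U : set R, [/\ open U, (forall x, Omega x -> U (rho0 x)) &
      forall r, U r -> 0 < r ->
        Aq <= derive1 q r /\ Aq <= derive1 (fun s => q s / s) r]
}.

Record initial_data (rho0 : 'rV[R]_3 -> R) (v0 : 'rV[R]_3 -> 'rV[R]_3)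
  : Prop := {
  id_v0_periodic : periodic_x Omega v0;
  id_v0_smooth : forall al, smooth_in ebase Omega (cpt v0 al);
  id_rho0_periodic : periodic_x Omega rho0;
  id_rho0_smooth : smooth_in ebase Omega rho0;
  id_rho0_bound : exists c : R, 0 < c /\ forall x, Omega x -> c <= rho0 x
}.

(* "Smooth on [0, T)" means up to t = 0 and up to the boundary of Omega, where
   the equations on Gamma_0 and Gamma_1 are evaluated. *)
Record smooth_solution (sigma : R) (q : R -> R) (rho0 : 'rV[R]_3 -> R)
    (v0 : 'rV[R]_3 -> 'rV[R]_3) (v : spacetime -> 'rV[R]_3)
    (rho : spacetime -> R) (eta : spacetime -> 'rV[R]_3) : Prop := {
  sol_v_periodic : forall t, 0 <= t < T ->
    periodic_x Omegac (fun x => v (t, x));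
  sol_rho_periodic : forall t, 0 <= t < T ->
    periodic_x Omegac (fun x => rho (t, x));
  sol_v_smooth : forall al, smooth_st (cpt v al);
  sol_rho_smooth : smooth_st rho;
  sol_rho_pos : forall p, E p -> 0 < rho p;
  sol_flow : is_flow_map v eta;
  sol_inv : forall p, E p -> inv_flow eta p *m grad_flow eta p = 1%:M;
  sol_momentum : forall p, cyl T Omega p -> forall al,
    rho p * dt (cpt v al) p
      + \sum_(mu < 3) aentry eta mu al p * dx mu (q \o rho) p = 0;
  sol_mass : forall p, cyl T Omega p ->
    dt rho p
      + rho p * \sum_(mu < 3) \sum_(al < 3)
          aentry eta mu al p * dx mu (cpt v al) p = 0;
  sol_a : forall p, cyl T Omega p -> forall al be,
    dt (aentry eta al be) p
      + \sum_(ga < 3) \sum_(mu < 3)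
          aentry eta al ga p * dx mu (cpt v ga) p * aentry eta mu be p = 0;
  sol_Gamma1 : forall p, cyl T Gamma1 p -> forall al,
    \sum_(mu < 3) aentry eta mu al p * outer_normal p.2 0 mu * q (rho p)
      + sigma * norm_aTN eta p * laplace_g eta (cpt eta al) p = 0;
  sol_Gamma0 : forall p, cyl T Gamma0 p ->
    \sum_(mu < 3) v p 0 mu * outer_normal p.2 0 mu = 0;
  sol_rho_init : forall x, Omega x -> rho (0, x) = rho0 x;
  sol_v_init : forall x, Omega x -> v (0, x) = v0 x
}.

End Lagrangian.

(* Main.v *)
Require Import Defs.
From mathcomp Require Import all_boot all_order all_algebra.
From mathcomp Require Import all_classical all_reals all_analysis.
From mathcomp Require Import ring lra.
Import Order.TTheory GRing.Theory Num.Theory.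
Import numFieldNormedType.Exports.
Local Open Scope classical_set_scope.
Local Open Scope ring_scope.

(** The quantity W^al = eps^{al be ga} d_be v^mu d_ga eta_mu is the pullback of
    the vorticity by the flow, and it does not depend on time. Since
    d_t eta = v,

      d_t W^al = eps^{al be ga} (d_be d_t v^mu d_ga eta_mu + d_be v^mu d_ga v_mu).

    The second term is symmetric in be and ga. For the first, the contraction of
    the momentum equation with d_ga eta_mu, the inverse of a, gives

      d_t v^mu d_ga eta_mu = - (q'(rho) / rho) d_ga rho

    ([momentum_pullback]). The d_be-derivative of the right-hand side is symmetric
    in be and ga, and so is the term d_t v^mu d_be d_ga eta_mu that the product
    rule produces on the left ([vorticity_rate_sym]). Contraction with the
    antisymmetric symbol makes all of this vanish, so W is constant in time by the
    mean value theorem ([vorticity_conserved]), and at t = 0, where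
    grad eta = 1 and v = v0, it is curl v0.

    Two analytic points support the computation. First, mixed derivatives
    commute: they do at interior points of [0, T) x Omega ([schwarz],
    [deriv_inC]), and this suffices because the mean value theorem on [0, t]
    needs the rate of W at positive times only. Secondly, eta is given merely as
    a time primitive of v, and its spatial derivatives, to second order, have to
    be shown to exist. A time primitive of a function with continuous spatial
    derivative is spatially differentiable, and its derivative is a time
    primitive of that derivative ([spatial_derive]); this is applied to eta and
    then to grad eta. *)

(** * Mean values and mixed derivatives along lines *)

Lemma incr_in_near {R : realType} {V : normedModType R} (E : set V) (v p : V) :
  (\forall h \near (0 : R), E (h *: v + p)) -> incr_in E v p = 0^'.
Proof.
move=> nE0; have nE := nbhs_dnbhs nE0.
apply/seteqP; split => A; rewrite /incr_in /within /=.
  by move=> wA; near=> h; apply: (near wA h) => //=; near: h.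
by move=> nA; near=> h => _; near: h.
Unshelve. all: by end_near. Qed.

Lemma cvg_line {R : realType} {V : normedModType R} (v p : V) :
  (fun h : R => h *: v + p) @ (0 : R) --> p.
Proof.
have : (fun h : R => h *: v + p) @ (0 : R) --> (0 : R) *: v + p.
  by apply: cvgD; [apply: cvgZr_tmp|]; apply: cvg_cst || exact: cvg_id.
by rewrite scale0r add0r.
Qed.

Section DirectionalCalculus.
Context {R : realType} {V : normedModType R}.
Implicit Types (f g : V -> R) (u v w p : V).

Lemma diffq_cvg_derivable f v p l :
  diffq f v p @ 0^' --> l -> is_derive p v f l.
Proof.
move=> fl; apply: DeriveDef; first by apply/cvg_ex; exists l.
exact: (cvg_lim _ fl).
Qed.

Lemma is_derive_line f v p (s : R) : derivable f (s *: v + p) v ->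
  is_derive s (1 : R) (fun h => f (h *: v + p)) ('D_v f (s *: v + p)).
Proof.
move=> df.
have E : (fun h : R => h^-1 *:
      (((fun h => f (h *: v + p)) \o shift s) (h *: (1 : R)) - f (s *: v + p))) =
    (fun h : R => h^-1 *:
      ((f \o shift (s *: v + p)) (h *: v) - f (s *: v + p))).
  by apply/funext => h /=; rewrite [h%:A]mulr1 scalerDl addrA.
apply: DeriveDef; first by rewrite /derivable E.
by rewrite /derive E.
Qed.

Lemma mvt_line f v p (h : R) :
  (forall s : R, `|s| <= `|h| -> derivable f (s *: v + p) v) ->
  exists2 c : R, `|c| <= `|h| & f (h *: v + p) - f p = h * 'D_v f (c *: v + p).
Proof.
move=> df; pose phi (s : R) := f (s *: v + p).
have dphi (s : R) : `|s| <= `|h| -> is_derive s (1 : R) phi ('D_v f (s *: v + p)).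
  by move=> /df; exact: is_derive_line.
have phi0 : phi 0 = f p by rewrite /phi scale0r add0r.
have [h0|h0] := leP 0 h.
- have [s||c ch E] := @MVT_segment R phi (fun s => 'D_v f (s *: v + p)) 0 h h0.
  + by rewrite in_itv /= => /andP[s0 sh]; apply: dphi; rewrite !ger0_norm // ltW.
  + apply: derivable_within_continuous => s; rewrite in_itv /= => /andP[s0 sh].
    by apply: ex_derive; apply: dphi; rewrite !ger0_norm.
  exists c; first by move: ch; rewrite in_itv /= => /andP[c0 cl]; rewrite !ger0_norm.
  by rewrite -phi0 -[f (h *: v + p)]/(phi h) E subr0 mulrC.
- have [s||c ch E] := @MVT_segment R phi (fun s => 'D_v f (s *: v + p)) h 0 (ltW h0).
  + by rewrite in_itv /= => /andP[sh s0]; apply: dphi; rewrite !ltr0_norm// lerN2 ltW.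
  + apply: derivable_within_continuous => s; rewrite in_itv /= => /andP[sh s0].
    by apply: ex_derive; apply: dphi; rewrite (ltr0_norm h0) ler0_norm// lerN2.
  exists c.
    move: ch; rewrite in_itv /= => /andP[? ?].
    by rewrite (ltr0_norm h0) ler0_norm// lerN2.
  by rewrite -phi0 -[f (h *: v + p)]/(phi h) -opprB E sub0r mulrN opprK mulrC.
Qed.

(** The second difference over the parallelogram spanned by h u and h w is the
    increment along u of y |-> f (y + h w) - f y, so two applications of the
    mean value theorem turn it into h^2 times one mixed derivative. Its symmetry
    in u and w is what makes mixed derivatives commute. *)
Lemma second_difference_mean_value f u w p (h : R) :
  (forall s r : R, `|s| <= `|h| -> `|r| <= `|h| ->
     derivable f (s *: u + (r *: w + p)) u /\
     derivable (fun y => 'D_u f y) (s *: u + (r *: w + p)) w) ->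
  exists c d : R, [/\ `|c| <= `|h|, `|d| <= `|h| &
    f (h *: u + (h *: w + p)) - f (h *: w + p) - (f (h *: u + p) - f p)
      = h * h * 'D_w (fun y => 'D_u f y) (c *: u + (d *: w + p))].
Proof.
move=> df.
have n0 : `|0 : R| <= `|h| by rewrite normr0.
pose phi y := f (y + h *: w) - f y.
have lineA (s r : R) : s *: u + (r *: w + p) = s *: u + p + r *: w.
  by rewrite addrCA addrC.
have dfu (s : R) : `|s| <= `|h| -> derivable f (s *: u + p) u.
  by move=> sh; have := (df s 0 sh n0).1; rewrite scale0r add0r.
have shiftd (s : R) : `|s| <= `|h| ->
    is_derive (s *: u + p) u (fun y => f (y + h *: w)) ('D_u f (s *: u + p + h *: w)).
  move=> sh; have /derivableP := (df s h sh (lexx _)).1; rewrite lineA => -[d1 d2].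
  have E : (fun k : R => k^-1 *:
        (((fun y => f (y + h *: w)) \o shift (s *: u + p)) (k *: u)
           - f (s *: u + p + h *: w))) =
      (fun k : R => k^-1 *:
        ((f \o shift (s *: u + p + h *: w)) (k *: u)
           - f (s *: u + p + h *: w))).
    by apply/funext => k /=; rewrite -(addrA (k *: u)).
  by apply: DeriveDef; [rewrite /derivable E|rewrite /derive E].
have dphi (s : R) : `|s| <= `|h| -> is_derive (s *: u + p) u phi
   ('D_u f (s *: u + p + h *: w) - 'D_u f (s *: u + p)).
  by move=> sh; apply: is_deriveB; [exact: shiftd|exact/derivableP/dfu].
have [c ch E1] := @mvt_line phi u p h (fun s sh => @ex_derive _ _ _ _ _ _ _ (dphi s sh)).
have [d dh E2] : exists2 d : R, `|d| <= `|h| &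
    'D_u f (h *: w + (c *: u + p)) - 'D_u f (c *: u + p) =
    h * 'D_w (fun y => 'D_u f y) (c *: u + (d *: w + p)).
  have [|d dh E2] := @mvt_line (fun y => 'D_u f y) w (c *: u + p) h.
    by move=> r rh; rewrite addrCA; exact: (df c r ch rh).2.
  exists d; [exact: dh|rewrite E2 (addrCA (d *: w)); reflexivity].
exists c, d; split; [exact: ch|exact: dh|].
have -> : f (h *: u + (h *: w + p)) - f (h *: w + p) - (f (h *: u + p) - f p)
   = phi (h *: u + p) - phi p.
  by rewrite /phi lineA [h *: w + p]addrC; ring.
rewrite E1 (@derive_val _ _ _ _ _ _ _ (dphi c ch)) [c *: u + p + h *: w]addrC E2.
rewrite -mulrA; reflexivity.
Qed.

Lemma near_box u w p (P : V -> Prop) : (\forall q \near p, P q) ->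
  exists2 h : R, 0 < h &
    forall s r : R, `|s| <= h -> `|r| <= h -> P (s *: u + (r *: w + p)).
Proof.
move=> nP.
have cv : (fun z : R * R => z.1 *: u + (z.2 *: w + p)) @ ((0, 0) : R * R) --> p.
  have : (fun z : R * R => z.1 *: u + (z.2 *: w + p)) @ ((0, 0) : R * R)
     --> (0 : R) *: u + ((0 : R) *: w + p).
    apply: cvgD; first by apply: cvgZr_tmp; exact: cvg_fst.
    apply: cvgD; first by apply: cvgZr_tmp; exact: cvg_snd.
    exact: cvg_cst.
  by rewrite !scale0r !add0r.
have := cv _ nP; rewrite /= => -[[A B] [/= nA nB] AB].
move: nA nB => /nbhs_ballP[a /= a0 aA] /nbhs_ballP[b /= b0 bB].
exists (Num.min a b / 2); first by rewrite divr_gt0 // lt_min a0 b0.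
have lt2 : Num.min a b / 2 < Num.min a b.
  by rewrite ltr_pdivrMr // mulr_natr mulr2n ltrDl lt_min a0 b0.
move=> s r sh rh; apply: (AB (s, r)); split => /=.
- apply: aA; rewrite /ball /= sub0r normrN.
  by apply: (le_lt_trans sh); apply: (lt_le_trans lt2); rewrite ge_min lexx.
- apply: bB; rewrite /ball /= sub0r normrN.
  by apply: (le_lt_trans rh); apply: (lt_le_trans lt2); rewrite ge_min lexx orbT.
Qed.

(** The same second difference, divided by h^2, is a value of D_w D_u f and a
    value of D_u D_w f at points within h of p; by continuity both are within
    e/2 of the values at p. *)
Lemma schwarz f u w p :
  (\forall q \near p, [/\ derivable f q u, derivable f q w,
      derivable (fun y => 'D_u f y) q w & derivable (fun y => 'D_w f y) q u]) ->
  {for p, continuous (fun q => 'D_w (fun y => 'D_u f y) q)} ->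
  {for p, continuous (fun q => 'D_u (fun y => 'D_w f y) q)} ->
  'D_w (fun y => 'D_u f y) p = 'D_u (fun y => 'D_w f y) p.
Proof.
move=> nd c1 c2; apply/eqP; rewrite -subr_eq0 -normr_le0; apply/ler_addgt0Pr => e e0.
rewrite add0r.
have e20 : 0 < e / 2 by rewrite divr_gt0.
move: c1 c2; rewrite /prop_for /continuous_at.
move=> /cvgrPdist_lt/(_ _ e20) n1 /cvgrPdist_lt/(_ _ e20) n2.
have [h h0 box] := near_box u w p _ (filterI nd (filterI n1 n2)).
have hh : `|h| = h by rewrite gtr0_norm.
have [s r sh rh|c [d [ch dh E1]]] := @second_difference_mean_value f u w p h.
  by rewrite hh in sh rh; have [[]] := box s r sh rh.
have [s r sh rh|c' [d' [ch' dh' E2]]] := @second_difference_mean_value f w u p h.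
  by rewrite hh in sh rh; have [[]] := box r s rh sh; rewrite addrCA.
rewrite hh in ch dh ch' dh'.
have [_ [B1 _]] := box c d ch dh.
have [_ [_]] := box d' c' dh' ch'; rewrite addrCA => B2.
set X := 'D_w _ (c *: u + _) in E1 B1; set Y := 'D_u _ (c' *: w + _) in E2 B2.
(* X and Y become opaque: unification would otherwise unfold the limits that
   define them. *)
clearbody X Y.
have swap (a b c0 d0 : R) : a - b - (c0 - d0) = a - c0 - (b - d0) by ring.
have XY : X = Y.
  apply: (@mulfI _ (h * h)); first by rewrite mulf_neq0 // gt_eqF.
  rewrite -E1 -E2 (addrCA (h *: w)); exact: swap.
move: B1 B2; move: ('D_w _ p) ('D_u _ p) => A B B1; rewrite -XY distrC => B2.
apply: (le_trans (ler_distD X A B)); rewrite (splitr e).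
by apply: lerD; exact: ltW.
Qed.

Lemma is_derive_comp (h : R -> R) f v p :
  derivable h (f p) 1 -> derivable f p v ->
  is_derive p v (h \o f) (derive1 h (f p) * 'D_v f p).
Proof.
move=> dh df.
pose phi (s : R) := f (s *: v + p).
have phi0 : phi 0 = f p by rewrite /phi scale0r add0r.
have dphi : is_derive (0 : R) (1 : R) phi ('D_v f p).
  by have := @is_derive_line f v p 0; rewrite scale0r add0r; apply.
have d1 : derivable (h \o f) p v.
  apply/derivable1P/derivable1_diffP/(@differentiable_comp _ _ _ _ phi h).
  - by apply/derivable1_diffP; exact: ex_derive.
  - by rewrite phi0; apply/derivable1_diffP.
apply: DeriveDef => //.
have dcomp : is_derive (0 : R) (1 : R) (h \o phi) ('D_v (h \o f) p).
  by have := @is_derive_line (h \o f) v p 0; rewrite scale0r add0r; apply.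
have [_ <-] := dcomp; have [dphi1 <-] := dphi.
rewrite -!derive1E -phi0; apply: derive1_comp; first exact: dphi1.
by move: dh; rewrite -phi0; exact.
Qed.

End DirectionalCalculus.

(** The integral from a is a primitive to the right of a only; a choice of a to
    the left of the interval of interest keeps its left endpoint interior. *)
Lemma continuous_primitive {R : realType} (k : R -> R) (a b : R) :
  continuous k ->
  exists G : R -> R, forall s, a < s < b -> is_derive s (1 : R) G (k s).
Proof.
move=> ck; exists (fun x => (\int[lebesgue_measure]_(t in `[a, x]) k t)%R).
move=> s /andP[sa sb].
have [|||d1 d2] := @continuous_FTC1_closed R k a s b sb.
- apply: continuous_compact_integrable; first exact: segment_compact.
  exact: continuous_subspaceT.
- exact: sa.
- exact: ck.
by apply: DeriveDef; [exact: d1|rewrite -derive1E; exact: d2].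
Qed.

(** * Derivatives relative to a set *)

Section RelativeDerivative.
Context {R : realType} {V : normedModType R}.
Implicit Types (E : set V) (f g : V -> R) (v p : V).

#[local] Instance incr_in_filter E v p : Filter (incr_in E v p).
Proof. exact: within_filter. Qed.

Lemma incr_in_interior E v p : E° p -> incr_in E v p = 0^'.
Proof. by move=> Ep; apply: incr_in_near; exact: (cvg_line v p _ Ep). Qed.

Lemma is_derive_deriv_in E v f p : incr_in E v p = 0^' ->
  cvg (diffq f v p @ incr_in E v p) -> is_derive p v f (deriv_in E v f p).
Proof. by rewrite /deriv_in => ->; exact: derivableP. Qed.

Lemma diffq_cvg_continuous E v f p (l : R) :
  diffq f v p @ incr_in E v p --> l ->
  (fun h => f (h *: v + p)) @ incr_in E v p --> f p.
Proof.
move=> fl.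
have id0 : (fun h : R => h) @ incr_in E v p --> (0 : R).
  by do 2 apply: cvg_within_filter; exact: cvg_id.
have : (fun h => h * diffq f v p h + f p) @ incr_in E v p --> 0 * l + f p.
  exact: (cvgD (cvgM id0 fl) (cvg_cst _)).
rewrite mul0r add0r; apply: cvg_trans; apply: near_eq_cvg.
rewrite /incr_in near_withinE; near=> h => _.
have h0 : h != 0 by near: h; exact: nbhs_dnbhs_neq.
by rewrite /diffq mulVKf // subrK.
Unshelve. all: by end_near. Qed.

(** At an interior point the increments that stay in E form a full punctured
    neighbourhood of 0, so relative derivatives are directional derivatives and
    commute by [schwarz]. *)
Lemma deriv_inC {I : Type} (e : I -> V) E f p (i j : I) :
  smooth_in e E f -> E° p ->
  deriv_in E (e i) (deriv_in E (e j) f) p =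
  deriv_in E (e j) (deriv_in E (e i) f) p.
Proof.
move=> sf Ep.
have nE q : E° q -> \forall y \near q, E° y.
  by move=> Eq; apply: open_nbhs_nbhs; split; [exact: open_interior|].
have D (s : seq I) k q : E° q ->
    is_derive q (e k) (foldr (fun i => deriv_in E (e i)) f s)
      (foldr (fun i => deriv_in E (e i)) f (k :: s) q).
  move=> Eq; apply: is_derive_deriv_in; first exact: incr_in_interior.
  by apply: (sf s).2; exact: interior_subset.
have nD k q : E° q -> \forall y \near q, deriv_in E (e k) f y = 'D_(e k) f y.
  by move=> Eq; apply: filterS (nE q Eq) => y /(D [::] k) [].
have DD k l q : E° q ->
    deriv_in E (e k) (deriv_in E (e l) f) q = 'D_(e k) (fun y => 'D_(e l) f y) q.
  by move=> Eq; have [_ /= <-] := D [:: l] k q Eq; apply: near_eq_derive; exact: nD.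
have cont k l : {for p, continuous (fun q => 'D_(e k) (fun y => 'D_(e l) f y) q)}.
  have /(_ p) := (sf [:: k; l]).1.
  rewrite /prop_for /continuous_at -(nbhs_subspace_interior Ep) /= => c.
  rewrite -(DD k l p Ep); apply: cvg_trans c; apply: near_eq_cvg.
  by apply: filterS (nE p Ep) => q; exact: DD.
rewrite (DD i j p Ep) (DD j i p Ep); apply: schwarz; [|exact: cont|exact: cont].
apply: filterS (nE p Ep) => q Eq.
have toD k l : derivable (fun y => 'D_(e l) f y) q (e k).
  have [d _] := D [:: l] k q Eq; apply: near_eq_derivable d.
  exact: nD.
by split; [have [] := D [::] j q Eq|have [] := D [::] i q Eq|exact: toD|exact: toD].
Qed.
End RelativeDerivative.

(** * Differentiation in time on [0, T) x Omega *)

Section SpaceTime.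
Context {R : realType} (T : R).
Local Notation spacetime := (R * 'rV[R]_3)%type.
Local Notation E := (cyl T Omegac).
Implicit Types (f g : spacetime -> R) (p : spacetime) (x : 'rV[R]_3).

Lemma st_spaceE (i : 'I_3) (h s : R) x :
  h *: ebase_st (Some i) + (s, x) = (s, h *: ebase i + x).
Proof. by congr (_, _); rewrite /= scaler0 add0r. Qed.

Lemma st_timeE (h s : R) x : h *: ebase_st None + (s, x) = (h + s, x).
Proof. by congr (_, _); rewrite /= ?scaler0 ?add0r // [_%:A]mulr1. Qed.

Lemma open_Omega : open (@Omega R).
Proof.
have -> : @Omega R = (fun x : 'rV[R]_3 => x 0 x3) @^-1` `]0, 1[%classic.
  by apply/seteqP; split => x; rewrite /Omega /= in_itv.
apply: open_comp; last exact: interval_open.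
by move=> x _; exact: coord_continuous.
Qed.

Lemma near_Omega_line (e x : 'rV[R]_3) : Omega x ->
  \forall h \near (0 : R), Omega (h *: e + x).
Proof.
by move=> Ox; exact: (cvg_line e x _ (open_nbhs_nbhs (conj open_Omega Ox))).
Qed.

Lemma Omega_Omegac x : Omega x -> Omegac x.
Proof. by move=> /andP[? ?]; apply/andP; split; exact: ltW. Qed.

Lemma cyl_Omega_Omegac p : cyl T Omega p -> E p.
Proof. by move=> [? ?]; split => //; exact: Omega_Omegac. Qed.

Lemma near_cyl_Omega (t : R) x : 0 < t < T -> Omega x ->
  \forall p \near (t, x), cyl T Omega p.
Proof.
move=> tT Ox; exists (`]0, T[%classic, Omega) => /=.
  split; first by apply: open_nbhs_nbhs; split; [exact: interval_open|rewrite /= in_itv].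
  by apply: open_nbhs_nbhs; split; [exact: open_Omega|].
move=> [s y] /= [+ Oy]; rewrite in_itv /= => /andP[s0 sT].
by split => //=; rewrite ltW.
Qed.

Lemma cyl_interior (t : R) x : 0 < t < T -> Omega x -> E° (t, x).
Proof.
move=> tT Ox; apply: filterS (near_cyl_Omega t x tT Ox) => p.
exact: cyl_Omega_Omegac.
Qed.

Lemma incr_in_space (i : 'I_3) p : cyl T Omega p ->
  incr_in E (ebase_st (Some i)) p = 0^'.
Proof.
case: p => s x [/= sT Ox]; apply: incr_in_near.
have nO := near_Omega_line (ebase i) x Ox.
apply: filterS nO => h /= Oh; rewrite st_spaceE.
by split => //; exact: Omega_Omegac.
Qed.

Lemma incr_in_time (t : R) x : 0 < t < T -> Omega x ->
  incr_in E (ebase_st None) (t, x) = 0^'.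
Proof. by move=> tT Ox; apply/incr_in_interior/cyl_interior. Qed.

(** [has_dt f g] is d_t f = g together with the existence of the limit: [dt]
    alone returns a junk value where the difference quotients diverge. At t = 0
    the limit is one-sided. *)
Definition has_dt f g := forall p, cyl T Omega p ->
  diffq f (ebase_st None) p @ incr_in E (ebase_st None) p --> g p.

Lemma has_dt_line f g (s : R) x : has_dt f g -> 0 < s < T -> Omega x ->
  is_derive s (1 : R) (fun r => f (r, x)) (g (s, x)).
Proof.
move=> fg sT Ox.
have /fg : cyl T Omega (s, x) by split => //=; case/andP: sT => /ltW -> ->.
rewrite incr_in_time // => /diffq_cvg_derivable.
have -> : (s, x) = s *: ebase_st None + (0, x) by rewrite st_timeE addr0.
move=> [d <-].
have := is_derive_line f (ebase_st None) (0, x) s d.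
by congr (is_derive _ _ _ _); apply/funext => r; rewrite st_timeE addr0.
Qed.

Lemma has_dt_continuous f g (t : R) x : has_dt f g -> t < T -> Omega x ->
  {within `[0, t], continuous (fun s => f (s, x))}.
Proof.
move=> fg tT Ox; apply/subspace_continuousP => s.
rewrite /= in_itv /= => /andP[s0 st].
have /fg : cyl T Omega (s, x) by split => //=; rewrite s0 (le_lt_trans st).
move=> /diffq_cvg_continuous /cvgrPdist_lt c; apply/cvgrPdist_lt => e e0.
have c1 : \forall h \near (0 : R), h != 0 -> E (h *: ebase_st None + (s, x)) ->
    `|f (s, x) - f (h *: ebase_st None + (s, x))| < e := c e e0.
have rs0 : (fun r => r - s) @ s --> (0 : R).
  by rewrite -(subrr s); apply: cvgB; [exact: cvg_id|exact: cvg_cst].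
have c3 : \forall r \near s, r - s != 0 ->
    E ((r - s) *: ebase_st None + (s, x)) ->
    `|f (s, x) - f ((r - s) *: ebase_st None + (s, x))| < e := rs0 _ c1.
rewrite near_withinE; apply: filterS c3 => r /=.
have [->|rs] := eqVneq r s; first by move=> _ _; rewrite subrr normr0.
rewrite st_timeE subrK subr_eq0 in_itv /= => /(_ rs) c2 /andP[r0 rt].
by apply: c2; split; [rewrite /= r0 (le_lt_trans rt)|exact: Omega_Omegac].
Qed.

Lemma has_dt_mvt f g (t : R) x : has_dt f g -> 0 < t < T -> Omega x ->
  exists2 c, 0 < c < t & f (t, x) - f (0, x) = g (c, x) * t.
Proof.
move=> fg /andP[t0 tT] Ox.
have [s||c ct E1] := @MVT R (fun s => f (s, x)) (fun s => g (s, x)) 0 t t0.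
- rewrite in_itv /= => /andP[s0 st]; apply: has_dt_line => //.
  by rewrite s0 (lt_trans st).
- exact: has_dt_continuous fg tT Ox.
- by exists c; [move: ct; rewrite in_itv|rewrite E1 subr0].
Qed.

Lemma has_dt_cvg f g p : has_dt f g -> cyl T Omega p ->
  (fun h => f (h *: ebase_st None + p)) @ incr_in E (ebase_st None) p --> f p.
Proof. by move=> fg /fg; exact: diffq_cvg_continuous. Qed.

Lemma has_dtD f1 g1 f2 g2 : has_dt f1 g1 -> has_dt f2 g2 ->
  has_dt (fun p => f1 p + f2 p) (fun p => g1 p + g2 p).
Proof.
move=> d1 d2 p Op.
have -> : diffq (fun p => f1 p + f2 p) (ebase_st None) p =
    (fun h => diffq f1 (ebase_st None) p h + diffq f2 (ebase_st None) p h).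
  by apply/funext => h; rewrite /diffq; ring.
exact: cvgD (d1 p Op) (d2 p Op).
Qed.

Lemma has_dtM f1 g1 f2 g2 : has_dt f1 g1 -> has_dt f2 g2 ->
  has_dt (fun p => f1 p * f2 p) (fun p => g1 p * f2 p + f1 p * g2 p).
Proof.
move=> d1 d2 p Op.
have -> : diffq (fun p => f1 p * f2 p) (ebase_st None) p =
    (fun h => diffq f1 (ebase_st None) p h * f2 (h *: ebase_st None + p) +
              f1 p * diffq f2 (ebase_st None) p h).
  by apply/funext => h; rewrite /diffq; ring.
apply: cvgD; first exact: (cvgM (d1 p Op) (has_dt_cvg _ _ _ d2 Op)).
exact: (cvgM (cvg_cst _) (d2 p Op)).
Qed.

Lemma has_dt_cst (c : R) : has_dt (fun=> c) (fun=> 0).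
Proof.
move=> p Op.
have -> : diffq (fun=> c) (ebase_st None) p = (fun=> 0).
  by apply/funext => h; rewrite /diffq subrr mulr0.
exact: cvg_cst.
Qed.

Lemma has_dt_sum (I : Type) (s : seq I) (f g : I -> spacetime -> R) :
  (forall i, has_dt (f i) (g i)) ->
  has_dt (fun p => \sum_(i <- s) f i p) (fun p => \sum_(i <- s) g i p).
Proof.
move=> d; elim: s => [|i s IH].
  have E0 (k : I -> spacetime -> R) : (fun p => \sum_(i <- [::]) k i p) = (fun=> 0).
    by apply/funext => p; rewrite big_nil.
  by rewrite !E0; exact: has_dt_cst.
have E1 (k : I -> spacetime -> R) : (fun p => \sum_(i <- i :: s) k i p) =
    (fun p => k i p + \sum_(i <- s) k i p).
  by apply/funext => p; rewrite big_cons.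
by rewrite !E1; apply: has_dtD.
Qed.

(** The rates are compared at positive times only, where points are interior and
    [deriv_inC] applies to them. *)
Lemma has_dt_init_eq f1 g1 f2 g2 : has_dt f1 g1 -> has_dt f2 g2 ->
  (forall t x, 0 < t < T -> Omega x -> g1 (t, x) = g2 (t, x)) ->
  (forall x, Omega x -> f1 (0, x) = f2 (0, x)) ->
  forall p, cyl T Omega p -> f1 p = f2 p.
Proof.
move=> d1 d2 g12 f0 [t x] [/= /andP[t0 tT] Ox].
have [->|tn0] := eqVneq t 0; first exact: f0.
have tp : 0 < t by rewrite lt_neqAle eq_sym tn0.
have dd := has_dtD _ _ _ _ d1 (has_dtM _ _ _ _ (has_dt_cst (-1)) d2).
have [|c /andP[c0 ct] /=] := has_dt_mvt _ _ t x dd _ Ox; first by rewrite tp tT.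
rewrite f0 // g12 ?c0 ?(lt_trans ct) // => /eqP.
rewrite !mulN1r subrr subr0 mul0r add0r subrr mul0r subr_eq0 => /eqP; exact.
Qed.

End SpaceTime.

(** * Spatial differentiability of time primitives *)

Section SpatialDerivative.
Context {R : realType} (T : R).
Local Notation spacetime := (R * 'rV[R]_3)%type.
Local Notation E := (cyl T Omegac).
Implicit Types (f g : spacetime -> R) (p : spacetime) (x : 'rV[R]_3).

(** Compactness of [0, t] makes continuity in space uniform in time. *)
Lemma uniform_shift (k : spacetime -> R) (e x : 'rV[R]_3) (t eps : R) :
  t < T -> Omega x ->
  (forall p, cyl T Omega p -> k @ within E (nbhs p) --> k p) -> 0 < eps ->
  \forall h \near (0 : R), forall s, 0 <= s <= t ->
    Omega (h *: e + x) /\ `|k (s, x) - k (s, h *: e + x)| < eps.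
Proof.
move=> tT Ox ck eps0.
have nO := near_Omega_line e x Ox.
have e2 : 0 < eps / 2 by rewrite divr_gt0.
have /compact_near_coveringP nc := @segment_compact R 0 t.
pose P (h s : R) := 0 <= s <= t -> Omega (h *: e + x) ->
  `|k (s, x) - k (s, h *: e + x)| < eps.
have nP : \forall h \near (0 : R), `[0, t] `<=` P h.
  apply: (nc R (nbhs (0 : R)) P) => s /=; rewrite in_itv /= => st.
  have Csx : cyl T Omega (s, x).
    by split => //=; case/andP: st => -> /le_lt_trans ->.
  have /cvgrPdist_lt/(_ _ e2) c := ck _ Csx.
  have c1 : \forall q \near (s, x), E q -> `|k (s, x) - k q| < eps / 2 := c.
  have cv1 : (fun z : R * R => (z.1, z.2 *: e + x)) @ ((s, 0) : R * R) --> (s, x).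
    have cz1 : (fun z : R * R => z.1) @ ((s, 0) : R * R) --> s by exact: cvg_fst.
    have cz2 : (fun z : R * R => z.2 *: e + x) @ ((s, 0) : R * R) --> x; last first.
      exact: (cvg_pair cz1 cz2).
    have : (fun z : R * R => z.2 *: e + x) @ ((s, 0) : R * R) --> (0 : R) *: e + x.
      by apply: cvgD; [apply: cvgZr_tmp; exact: cvg_snd|exact: cvg_cst].
    by rewrite scale0r add0r.
  have cv2 : (fun z : R * R => (z.1, x)) @ ((s, 0) : R * R) --> (s, x).
    have cz1 : (fun z : R * R => z.1) @ ((s, 0) : R * R) --> s by exact: cvg_fst.
    exact: (cvg_pair cz1 (cvg_cst x)).
  have n1 : \forall z \near ((s, 0) : R * R), E (z.1, z.2 *: e + x) ->
    `|k (s, x) - k (z.1, z.2 *: e + x)| < eps / 2 := cv1 _ c1.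
  have n2 : \forall z \near ((s, 0) : R * R), E (z.1, x) ->
    `|k (s, x) - k (z.1, x)| < eps / 2 := cv2 _ c1.
  suff : \forall z \near ((s, 0) : R * R), P z.2 z.1 by [].
  apply: filterS (filterI n1 n2) => -[r h] /= [{}n1 {}n2] /andP[r0 rt] Oh.
  have rT : 0 <= r < T by rewrite r0 (le_lt_trans rt).
  have {}n1 := n1 (conj rT (Omega_Omegac _ Oh)).
  have {}n2 := n2 (conj rT (Omega_Omegac _ Ox)).
  rewrite distrC in n2; apply: (le_lt_trans (ler_distD (k (s, x)) _ _)).
  by rewrite (splitr eps) ltrD.
apply: filterS (filterI nO nP) => h [Oh Ph] s st; split; first exact: Oh.
by apply: Ph => //=; rewrite in_itv.
Qed.

Lemma dxE (i : 'I_3) f p : cyl T Omega p -> dx T i f p = 'D_(ebase_st (Some i)) f p.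
Proof. by move=> Op; rewrite /dx /deriv_in incr_in_space. Qed.

(** Let f have time derivative g and let G be a primitive of s |-> d_i g (s, x).
    The time derivative of (spatial difference quotient of f) - G is a
    difference quotient of g minus d_i g, that is, by the mean value theorem,
    the variation of d_i g over a segment of length at most |h|. The drift over
    [0, s] is then at most b * s when that variation is at most b. *)
Lemma difference_quotient_drift (i : 'I_3) f g (G : R -> R) x (h s b : R) :
  has_dt T f g ->
  (forall p, cyl T Omega p -> derivable g p (ebase_st (Some i))) ->
  0 <= s < T -> Omega x -> h != 0 -> 0 <= b ->
  (forall r : R, 0 <= r <= s -> is_derive r (1 : R) G (dx T i g (r, x))) ->
  (forall th : R, `|th| <= `|h| -> forall r : R, 0 <= r <= s ->
     Omega (th *: ebase i + x) /\
     `|dx T i g (r, x) - dx T i g (r, th *: ebase i + x)| <= b) ->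
  `|(diffq f (ebase_st (Some i)) (s, x) h - G s) -
    (diffq f (ebase_st (Some i)) (0, x) h - G 0)| <= b * s.
Proof.
move=> fg dg /andP[s0 sT] Ox h0 b0 dG close.
have s0s : 0 <= (0 : R) <= s by rewrite lexx.
have Oh : Omega (h *: ebase i + x) := (close h (lexx _) 0 s0s).1.
pose psi (r : R) : R := h^-1 *: (f (r, h *: ebase i + x) - f (r, x)) - G r.
pose dpsi (r : R) : R := h^-1 *: (g (r, h *: ebase i + x) - g (r, x)) - dx T i g (r, x).
have psiE r : diffq f (ebase_st (Some i)) (r, x) h - G r = psi r.
  by rewrite /diffq st_spaceE.
have der (r : R) : r \in `]0, s[ -> is_derive r (1 : R) psi (dpsi r).
  rewrite in_itv /= => /andP[r0 rs].
  have rT : 0 < r < T by rewrite r0 (lt_trans rs).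
  apply: is_deriveB; last by apply: dG; rewrite !ltW.
  apply: is_deriveZ; apply: is_deriveB.
  - exact: (has_dt_line _ _ _ _ _ fg rT Oh).
  - exact: (has_dt_line _ _ _ _ _ fg rT Ox).
have cont : {within `[0, s], continuous psi}.
  move=> r.
  have C1 := has_dt_continuous _ _ _ _ _ fg sT Oh r.
  have C2 := has_dt_continuous _ _ _ _ _ fg sT Ox r.
  have C3 : {within `[0, s], continuous G}.
    apply: derivable_within_continuous => z; rewrite in_itv /= => zs.
    by have [] := dG z zs.
  exact: (cvgB (cvgZl_tmp (k := h^-1) (cvgB C1 C2)) (C3 r)).
have [c cs E1] := MVT_segment s0 der cont.
move: cs; rewrite in_itv /= => cs.
have Oc y : Omega y -> cyl T Omega (c, y).
  by move=> Oy; split => //=; case/andP: cs => -> /le_lt_trans ->.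
have [|th thh E2] := mvt_line g (ebase_st (Some i)) (c, x) h.
  move=> th thh; rewrite st_spaceE; apply: dg; apply: Oc.
  exact: (close th thh 0 s0s).1.
have [Oth bound] := close th thh c cs.
rewrite !psiE E1 subr0 normrM (ger0_norm s0) ler_wpM2r //.
have -> : dpsi c = dx T i g (c, th *: ebase i + x) - dx T i g (c, x).
  rewrite /dpsi -st_spaceE E2 -dxE ?st_spaceE; last exact: Oc.
  by congr (_ - _); rewrite -[_ *: _]/(_ * _) mulKf.
by rewrite distrC.
Qed.

(** Differentiation under the integral sign, for f = f(0, .) + int_0^t g: f is
    spatially differentiable because g is, and d_t d_i f = d_i g. The difference
    quotients of f converge to those at time 0 plus int_0^t d_i g by
    [difference_quotient_drift]; the integral enters only through the existence
    of a primitive of d_i g (., x). *)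
Lemma spatial_derive (i : 'I_3) f g :
  has_dt T f g ->
  (forall p, cyl T Omega p -> derivable g p (ebase_st (Some i))) ->
  (forall p, cyl T Omega p -> dx T i g @ within E (nbhs p) --> dx T i g p) ->
  (forall x, Omega x -> derivable f (0, x) (ebase_st (Some i))) ->
  (forall p, cyl T Omega p -> derivable f p (ebase_st (Some i))) /\
  has_dt T (dx T i f) (dx T i g).
Proof.
move=> fg dg cg f0.
pose e : 'rV[R]_3 := ebase i.
have main (t : R) x : 0 <= t < T -> Omega x -> exists2 G : R -> R,
   (forall s, 0 <= s <= t -> is_derive s (1 : R) G (dx T i g (s, x))) &
   (forall s, 0 <= s <= t -> is_derive (s, x) (ebase_st (Some i)) f
      (dx T i f (0, x) + (G s - G 0))).
  move=> /andP[t0 tT] Ox.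
  (* d_i g (., x) is continuous on [0, T) only; clamping time to [0, t] extends
     it from [0, t] to a function continuous on the whole line. *)
  pose clamp (s : R) := Num.max 0 (Num.min s t).
  have clampE s : 0 <= s <= t -> clamp s = s.
    by move=> /andP[s0 st]; rewrite /clamp min_l // max_r.
  have clampC s : 0 <= clamp s < T.
    by rewrite /clamp le_max lexx /= gt_max (le_lt_trans t0) //= gt_min tT orbT.
  have kc : continuous (fun s => dx T i g (clamp s, x)).
    move=> s; have /cvgrPdist_lt c := cg (clamp s, x) (conj (clampC s) Ox).
    apply/cvgrPdist_lt => eps eps0.
    have c1 : \forall q \near (clamp s, x), E q ->
      `|dx T i g (clamp s, x) - dx T i g q| < eps := c _ eps0.
    have cc : (fun r => (clamp r, x)) @ s --> (clamp s, x).
      have c0 : clamp @ s --> clamp s.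
        apply: (@continuous_max _ _ (cst 0) (fun r => Num.min r t)); first exact: cvg_cst.
        by apply: (@continuous_min _ _ id (cst t)); [exact: cvg_id|exact: cvg_cst].
      exact: (cvg_pair c0 (cvg_cst x)).
    have c2 : \forall r \near s, E (clamp r, x) ->
      `|dx T i g (clamp s, x) - dx T i g (clamp r, x)| < eps := cc _ c1.
    by apply: filterS c2 => r; apply; split; [exact: clampC|exact: Omega_Omegac].
  have [G dG] := continuous_primitive _ (-1) (t + 1) kc.
  have dGx s : 0 <= s <= t -> is_derive s (1 : R) G (dx T i g (s, x)).
    move=> st; rewrite -{2}(clampE s st); apply: dG; case/andP: st => s0 st.
    by rewrite (lt_le_trans _ s0) ?ltrN10 //= (le_lt_trans st) // ltrDl.
  exists G; first exact: dGx.
  move=> s st; apply: diffq_cvg_derivable; apply/cvgrPdist_lt => eps eps0.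
  have [s0 st'] := andP st.
  have e2 : 0 < eps / 2 by rewrite divr_gt0.
  have t1 : 0 < t + 1 by rewrite ltr_wpDl.
  pose b := eps / 2 / (t + 1).
  have b0 : 0 < b by rewrite divr_gt0.
  have Cyl r : 0 <= r <= t -> cyl T Omega (r, x).
    by move=> /andP[r0 rt]; split => //=; rewrite r0 (le_lt_trans rt).
  have C0 : cyl T Omega (0, x) by apply: Cyl; rewrite lexx.
  have /cvgrPdist_lt/(_ _ e2) n0 :
      diffq f (ebase_st (Some i)) (0, x) @ 0^' --> dx T i f (0, x).
    by rewrite dxE //; exact: f0.
  have /nbhs_ballP[d /= d0 dball] := uniform_shift (dx T i g) e x t b tT Ox cg b0.
  have nd : \forall h \near (0 : R)^', `|h| < d.
    apply: nbhs_dnbhs; apply/nbhs_ballP; exists d => // h.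
    by rewrite /ball /= sub0r normrN.
  have nn0 : \forall h \near (0 : R)^', h != 0 by exact: nbhs_dnbhs_neq.
  apply: filterS (filterI n0 (filterI nd nn0)) => h [{}n0 [hd h0]].
  have drift : `|(diffq f (ebase_st (Some i)) (s, x) h - G s) -
    (diffq f (ebase_st (Some i)) (0, x) h - G 0)| <= b * s.
    apply: (difference_quotient_drift i f g G x h s b fg dg _ Ox h0 (ltW b0)).
    - by rewrite s0 (le_lt_trans st').
    - by move=> r /andP[r0 rs]; apply: dGx; rewrite r0 (le_trans rs).
    - move=> th thh r /andP[r0 rs].
      have [||Oth lt] := dball th _ r; last by split; [exact: Oth|exact: ltW lt].
      + by rewrite /ball /= sub0r normrN (le_lt_trans thh).
      + by rewrite r0 (le_trans rs).
  have bs : b * s < eps / 2.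
    rewrite /b mulrAC ltr_pdivrMr // ltr_pM2l //.
    by rewrite (le_lt_trans st') // ltrDl.
  have -> : dx T i f (0, x) + (G s - G 0) - diffq f (ebase_st (Some i)) (s, x) h =
    (dx T i f (0, x) - diffq f (ebase_st (Some i)) (0, x) h) -
    ((diffq f (ebase_st (Some i)) (s, x) h - G s) -
     (diffq f (ebase_st (Some i)) (0, x) h - G 0)) by ring.
  by rewrite (le_lt_trans (ler_normB _ _)) // (splitr eps) ltrD // (le_lt_trans drift).
split => [[s x] [/= sT Ox]|[s x] [/= /andP[s0 sT] Ox]].
  have [G _ dF] := main s x sT Ox.
  have [|d _] := dF s; last exact: d.
  by rewrite lexx andbT; case/andP: sT.
(* The primitive G depends on the final time; a final time beyond s makes d_i f
   equal to G up to a constant on a neighbourhood of s in [0, T). *)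
have [st tT] : s < (s + T) / 2 /\ (s + T) / 2 < T by split; lra.
have t0 : 0 <= (s + T) / 2 < T by rewrite tT andbT ltW // (le_lt_trans s0).
have [G dG dF] := main _ x t0 Ox.
have valF r : 0 <= r <= (s + T) / 2 -> dx T i f (r, x) = dx T i f (0, x) + (G r - G 0).
  move=> /[dup] rt /dF [_ <-]; rewrite dxE //; split => //=.
  by case/andP: rt => -> /le_lt_trans ->.
have ss : 0 <= s <= (s + T) / 2 by rewrite s0 ltW.
have [d <-] := dG s ss.
have dq : diffq G 1 s @ incr_in E (ebase_st None) (s, x) --> 'D_1 G s.
  by apply: cvg_within_filter; exact: d.
apply: cvg_trans dq; apply: near_eq_cvg.
rewrite /incr_in near_withinE.
have near_s : \forall h \near (0 : R), h + s < (s + T) / 2.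
  have : (fun h : R => h + s) @ (0 : R) --> s.
    by rewrite -{2}(add0r s); apply: cvgD; [exact: cvg_id|exact: cvg_cst].
  by move/(_ _ (lt_nbhsl st)).
apply: filterS (nbhs_dnbhs near_s) => h hs /=; rewrite st_timeE => -[/= /andP[hs0 _] _].
have hss : 0 <= h + s <= (s + T) / 2 by rewrite hs0 ltW.
rewrite /diffq st_timeE (valF _ hss) (valF _ ss) [h *: 1]mulr1.
ring.
Qed.
End SpatialDerivative.

(** * Conservation of vorticity *)

Lemma levi_civita_contract_sym {R : realType} (S : 'I_3 -> 'I_3 -> R) (al : 'I_3) :
  (forall be ga, S be ga = S ga be) ->
  \sum_(be < 3) \sum_(ga < 3) levi_civita al be ga * S be ga = 0.
Proof.
move=> Ssym; set X := \sum_be _.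
have XN : X = - X.
  rewrite {1}/X exchange_big /= -sumrN; apply: eq_bigr => be _.
  rewrite -sumrN; apply: eq_bigr => ga _.
  by rewrite levi_civita_anti23 mulNr Ssym.
by clearbody X; lra.
Qed.

Section Smooth.
Context {R : realType} {T : R}.
Local Notation E := (cyl T Omegac).
Implicit Types (f : R * 'rV[R]_3 -> R) (p : R * 'rV[R]_3).

Lemma smooth_st_deriv f (o : option 'I_3) : smooth_st T f ->
  smooth_st T (deriv_in E (ebase_st o) f).
Proof. by move=> sf s; have := sf (rcons s o); rewrite /= foldr_rcons. Qed.

Lemma smooth_st_has_dt f : smooth_st T f -> has_dt T f (dt T f).
Proof.
move=> sf p Op; have := (sf [::]).2 None p (cyl_Omega_Omegac T p Op).
by rewrite /dt /deriv_in.
Qed.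

Lemma smooth_st_derivable f (i : 'I_3) p : smooth_st T f -> cyl T Omega p ->
  derivable f p (ebase_st (Some i)).
Proof.
move=> sf Op; have c := (sf [::]).2 (Some i) p (cyl_Omega_Omegac T p Op).
by have [] := is_derive_deriv_in _ _ _ _ (incr_in_space T i p Op) c.
Qed.

Lemma smooth_st_continuous f p : smooth_st T f -> cyl T Omega p ->
  f @ within E (nbhs p) --> f p.
Proof.
move=> sf Op; have /subspace_continuousP c := (sf [::]).1.
exact: (c p (cyl_Omega_Omegac T p Op)).
Qed.
End Smooth.

Section Solution.
Context {R : realType} (T sigma : R) (q : R -> R) (rho0 : 'rV[R]_3 -> R)
  (v0 : 'rV[R]_3 -> 'rV[R]_3) (v eta : R * 'rV[R]_3 -> 'rV[R]_3)
  (rho : R * 'rV[R]_3 -> R) (hT : 0 < T) (hq : equation_of_state q rho0)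
  (hsol : smooth_solution T sigma q rho0 v0 v rho eta).
Local Notation E := (cyl T Omegac).
Local Notation F mu ga := (dx T ga (cpt eta mu)).

Lemma cyl_init (x : 'rV[R]_3) : Omega x -> cyl T Omega ((0 : R), x).
Proof. by split => //=; rewrite lexx. Qed.

Lemma is_derive_eta_init (x : 'rV[R]_3) (ga mu : 'I_3) : Omega x ->
  is_derive ((0 : R), x) (ebase_st (Some ga)) (cpt eta mu) (ebase ga 0 mu).
Proof.
move=> Ox; apply: diffq_cvg_derivable.
have c : (fun=> ebase ga 0 mu) @ (0 : R)^' --> (ebase ga 0 mu : R) by exact: cvg_cst.
apply: cvg_trans c; apply: near_eq_cvg.
have nO := near_Omega_line (ebase ga) x Ox.
have nn0 : \forall h \near (0 : R)^', h != 0 by exact: nbhs_dnbhs_neq.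
apply: filterS (filterI (nbhs_dnbhs nO) nn0) => h [Oh h0] /=.
have id0 := (sol_flow hsol).1.
rewrite /diffq st_spaceE /cpt !id0; [|exact: Omega_Omegac|exact: Omega_Omegac].
by rewrite !mxE addrK mulKf.
Qed.

Lemma grad_eta_init (x : 'rV[R]_3) (ga mu : 'I_3) : Omega x ->
  F mu ga (0, x) = ebase ga 0 mu.
Proof.
move=> Ox; rewrite dxE; last exact: cyl_init.
by have [] := is_derive_eta_init x ga mu Ox.
Qed.

(** The flow map is known to be differentiable in time only; its spatial
    regularity comes from that of v through [spatial_derive]. *)
Lemma has_dt_grad_eta (ga mu : 'I_3) : has_dt T (F mu ga) (dx T ga (cpt v mu)).
Proof.
have sv := sol_v_smooth hsol mu.
apply: (spatial_derive T ga (cpt eta mu) (cpt v mu) _ _ _ _).2.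
- by move=> p /cyl_Omega_Omegac; exact: (sol_flow hsol).2.
- by move=> p; exact: smooth_st_derivable.
- by move=> p; apply: smooth_st_continuous; exact: smooth_st_deriv.
- by move=> x Ox; have [] := is_derive_eta_init x ga mu Ox.
Qed.

Lemma is_derive_grad_eta_init (x : 'rV[R]_3) (be ga mu : 'I_3) : Omega x ->
  is_derive ((0 : R), x) (ebase_st (Some be)) (F mu ga) 0.
Proof.
move=> Ox; apply: diffq_cvg_derivable.
have c : (fun=> 0) @ (0 : R)^' --> (0 : R) by exact: cvg_cst.
apply: cvg_trans c; apply: near_eq_cvg.
have nO := near_Omega_line (ebase be) x Ox.
apply: filterS (nbhs_dnbhs nO) => h Oh /=.
by rewrite /diffq st_spaceE !grad_eta_init // subrr mulr0.
Qed.

(** The product rule for d_be (d_t v^mu d_ga eta_mu) needs second derivatives of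
    eta; [spatial_derive] applies to grad eta since its time derivative grad v is
    smooth. *)
Lemma grad_eta_spatial_derive (be ga mu : 'I_3) :
  (forall p, cyl T Omega p -> derivable (F mu ga) p (ebase_st (Some be))) /\
  has_dt T (dx T be (F mu ga)) (dx T be (dx T ga (cpt v mu))).
Proof.
have sv : smooth_st T (dx T ga (cpt v mu)) := smooth_st_deriv _ _ (sol_v_smooth hsol mu).
apply: spatial_derive.
- exact: has_dt_grad_eta.
- by move=> p; exact: smooth_st_derivable.
- by move=> p; apply: smooth_st_continuous; exact: smooth_st_deriv.
- by move=> x Ox; have [] := is_derive_grad_eta_init x be ga mu Ox.
Qed.

(** Second derivatives of eta are time primitives of those of v with the same
    value 0 at t = 0; those of v commute since v is smooth. *)
Lemma dx_grad_eta_sym (be ga mu : 'I_3) p : cyl T Omega p ->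
  dx T be (F mu ga) p = dx T ga (F mu be) p.
Proof.
apply: (has_dt_init_eq _ _ _ _ _ (grad_eta_spatial_derive be ga mu).2
  (grad_eta_spatial_derive ga be mu).2).
- move=> t x tT Ox; apply: (deriv_inC ebase_st E (cpt v mu) _ (Some be) (Some ga)).
    exact: (sol_v_smooth hsol).
  exact: cyl_interior.
- move=> x Ox.
  have Ox0 := cyl_init x Ox; rewrite !(dxE T _ _ _ Ox0).
  have [_ E1] := is_derive_grad_eta_init x be ga mu Ox.
  have [_ E2] := is_derive_grad_eta_init x ga be mu Ox.
  exact: (etrans E1 (esym E2)).
Qed.

(* m(r) = q'(r) / r is the derivative of the enthalpy, so that
   m(rho) grad rho = (1 / rho) grad q(rho) is a gradient. *)
Local Notation m := (fun r => derive1 q r / r).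

(** Contraction of the momentum equation with grad eta, which a inverts, replaces
    the Eulerian gradient of the pressure by a gradient in x. *)
Lemma momentum_pullback (ga : 'I_3) p : cyl T Omega p ->
  \sum_(mu < 3) dt T (cpt v mu) p * F mu ga p = - (m (rho p) * dx T ga rho p).
Proof.
have delta (f : 'I_3 -> R) : \sum_(mu < 3) f mu * (mu == ga)%:R = f ga.
  rewrite (bigD1 ga) //= eqxx mulr1 big1 ?addr0 // => mu /negPf ->.
  by rewrite mulr0.
have swap (a b c : R) : a * b * c = b * (a * c) by rewrite mulrA (mulrC a).
move=> Op; have EO := cyl_Omega_Omegac T p Op.
have r0 : rho p != 0 by rewrite gt_eqF //; exact: (sol_rho_pos hsol).
have qrho mu : dx T mu (q \o rho) p = derive1 q (rho p) * dx T mu rho p.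
  rewrite !dxE //.
  have dq : derivable q (rho p) 1 :=
    @eos_smooth _ _ _ hq 0%N (rho p) (sol_rho_pos hsol EO).
  have drho : derivable rho p (ebase_st (Some mu)).
    exact: smooth_st_derivable (sol_rho_smooth hsol) Op.
  by have [_ ->] := is_derive_comp q rho _ p dq drho.
have inv mu : \sum_(al < 3) aentry T eta mu al p * F al ga p = (mu == ga)%:R.
  have /matrixP/(_ mu ga) := sol_inv hsol EO.
  rewrite !mxE => <-; apply: eq_bigr => al _.
  by rewrite /aentry [grad_flow _ _ _ _ _]mxE.
apply: (mulfI r0); rewrite mulrN mulrA mulrCA divff // mulr1.
rewrite mulr_sumr.
transitivity (\sum_(al < 3) - (\sum_(mu < 3) derive1 q (rho p) * dx T mu rho p *
   (aentry T eta mu al p * F al ga p))).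
  apply: eq_bigr => al _.
  have /eqP := sol_momentum hsol Op al; rewrite addr_eq0 => /eqP.
  rewrite mulrA => ->; rewrite mulNr mulr_suml; congr (- _).
  by apply: eq_bigr => mu _; rewrite qrho; exact: swap.
rewrite sumrN exchange_big /=; congr (- _).
under eq_bigr do rewrite -mulr_sumr inv.
exact: delta.
Qed.

(** By the product rule, d_be of [momentum_pullback] expresses
    d_be d_t v^mu d_ga eta_mu through d_be rho d_ga rho, d_be d_ga rho and
    d_be d_ga eta, each symmetric in be and ga. *)
Lemma vorticity_rate_sym (be ga : 'I_3) (t : R) (x : 'rV[R]_3) :
  0 < t < T -> Omega x ->
  \sum_(mu < 3) dt T (dx T be (cpt v mu)) (t, x) * F mu ga (t, x) =
  \sum_(mu < 3) dt T (dx T ga (cpt v mu)) (t, x) * F mu be (t, x).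
Proof.
move=> tT Ox; set p := (t, x).
have Op : cyl T Omega p by split => //=; case/andP: tT => /ltW -> ->.
have Ep : E° p by exact: cyl_interior.
have rp : 0 < rho p by apply: (sol_rho_pos hsol); exact: cyl_Omega_Omegac.
have dm : derivable m (rho p) 1.
  apply: derivableM; first exact: (@eos_smooth _ _ _ hq 1%N (rho p) rp).
  by apply: derivableV; [rewrite gt_eqF|exact: derivable_id].
have regroup (s a1 a2 b1 b2 : R) :
    - s + - (a1 *: a2 + b1 *: b2) = - (b2 * b1 + a1 * a2) - s.
  by rewrite addrC [X in - X - s]addrC (mulrC b2).
have key b c : \sum_(mu < 3) dt T (dx T b (cpt v mu)) p * F mu c p =
   - (derive1 m (rho p) * dx T b rho p * dx T c rho p +
      m (rho p) * dx T b (dx T c rho) p) -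
   \sum_(mu < 3) dt T (cpt v mu) p * dx T b (F mu c) p.
  pose e : (R * 'rV[R]_3)%type := ebase_st (Some b).
  have dtv mu : is_derive p e (dt T (cpt v mu)) (dt T (dx T b (cpt v mu)) p).
    have sv : smooth_st T (dt T (cpt v mu)) :=
      smooth_st_deriv _ None (sol_v_smooth hsol mu).
    have -> : dt T (dx T b (cpt v mu)) p = 'D_e (dt T (cpt v mu)) p.
      rewrite -(dxE T b _ p Op); apply: (deriv_inC ebase_st E (cpt v mu) p None (Some b)).
        exact: (sol_v_smooth hsol).
      exact: Ep.
    apply: derivableP; exact: smooth_st_derivable sv Op.
  have dF mu : is_derive p e (F mu c) (dx T b (F mu c) p).
    rewrite (dxE T b _ p Op); apply: derivableP.
    exact: (grad_eta_spatial_derive b c mu).1.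
  have d1 : is_derive p e (\sum_(mu < 3) (dt T (cpt v mu) * F mu c))
     (\sum_(mu < 3) (dt T (cpt v mu) p *: dx T b (F mu c) p +
        F mu c p *: dt T (dx T b (cpt v mu)) p)).
    have dM mu := is_deriveM (dtv mu) (dF mu).
    exact: (is_derive_sum dM).
  have srho := sol_rho_smooth hsol.
  have drho : is_derive p e rho (dx T b rho p).
    rewrite (dxE T b _ p Op); apply: derivableP; exact: smooth_st_derivable srho Op.
  have ddrho : is_derive p e (dx T c rho) (dx T b (dx T c rho) p).
    rewrite (dxE T b _ p Op); apply: derivableP.
    exact: smooth_st_derivable (smooth_st_deriv _ (Some c) srho) Op.
  have dmrho : is_derive p e (m \o rho) (derive1 m (rho p) * dx T b rho p).
    have [dr E1] := drho; rewrite -E1; exact: (is_derive_comp _ _ _ _ dm dr).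
  have d2 : is_derive p e (- ((m \o rho) * dx T c rho))
     (- (m (rho p) *: dx T b (dx T c rho) p +
         dx T c rho p *: (derive1 m (rho p) * dx T b rho p))).
    exact: (is_deriveN (is_deriveM dmrho ddrho)).
  have eqn : \forall y \near p, (\sum_(mu < 3) (dt T (cpt v mu) * F mu c)) y =
      (- ((m \o rho) * dx T c rho)) y.
    apply: filterS (near_cyl_Omega T t x tT Ox) => y Oy.
    by rewrite fct_sumE; exact: momentum_pullback.
  have := near_eq_derive e eqn.
  have [_ D1] := d1; have [_ D2] := d2; rewrite D1 D2.
  rewrite big_split /= => /(canRL (addKr _)) E1.
  transitivity (\sum_(mu < 3) F mu c p *: dt T (dx T b (cpt v mu)) p).
    by apply: eq_bigr => mu _; exact: mulrC.
  exact: (etrans E1 (regroup _ _ _ _ _)).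
have combine (a a' b b' k s s' : R) : a = a' -> b = b' -> s = s' ->
    - (a + k * b) - s = - (a' + k * b') - s' by move=> -> -> ->.
apply: (etrans (key be ga) (etrans _ (esym (key ga be)))); apply: combine.
- exact: mulrAC.
- apply: (deriv_inC ebase_st E rho p (Some be) (Some ga)).
    exact: (sol_rho_smooth hsol).
  exact: Ep.
- apply: eq_bigr => mu _; rewrite (dx_grad_eta_sym be ga mu p Op); reflexivity.
Qed.

(** The time derivative of eps^{al be ga} d_be v^mu d_ga eta_mu is
    eps^{al be ga} S_{be ga} with S symmetric: its two parts are the one of
    [vorticity_rate_sym] and d_be v^mu d_ga v_mu. *)
Lemma vorticity_conserved (al : 'I_3) (t : R) (x : 'rV[R]_3) :
  0 <= t < T -> Omega x ->
  \sum_(be < 3) \sum_(ga < 3) \sum_(mu < 3)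
    levi_civita al be ga * dx T be (cpt v mu) (t, x) * F mu ga (t, x) =
  \sum_(be < 3) \sum_(ga < 3) \sum_(mu < 3)
    levi_civita al be ga * dx T be (cpt v mu) (0, x) * F mu ga (0, x).
Proof.
move=> /andP[t0 tT] Ox; have [->//|tn0] := eqVneq t 0.
have {t0 tn0} t0 : 0 < t by rewrite lt_neqAle eq_sym tn0.
have dW := has_dt_sum T _ (index_enum 'I_3) _ _ (fun be =>
  has_dt_sum T _ (index_enum 'I_3) _ _ (fun ga =>
  has_dt_sum T _ (index_enum 'I_3) _ _ (fun mu =>
    has_dtM T _ _ _ _
      (has_dtM T _ _ _ _ (has_dt_cst T (levi_civita al be ga))
        (smooth_st_has_dt _ (smooth_st_deriv _ (Some be) (sol_v_smooth hsol mu))))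
      (has_dt_grad_eta ga mu)))).
have [|c /andP[c0 ct] E1] := has_dt_mvt T _ _ t x dW _ Ox; first by rewrite t0 tT.
have cT : 0 < c < T by rewrite c0 (lt_trans ct).
apply/eqP; rewrite -subr_eq0; apply/eqP; apply: (etrans E1).
pose S (be ga : 'I_3) := \sum_(mu < 3)
  (dt T (dx T be (cpt v mu)) (c, x) * F mu ga (c, x) +
   dx T be (cpt v mu) (c, x) * dx T ga (cpt v mu) (c, x)).
have Ssym be ga : S be ga = S ga be.
  have As := vorticity_rate_sym be ga c x cT Ox.
  have Bs : \sum_(mu < 3) dx T be (cpt v mu) (c, x) * dx T ga (cpt v mu) (c, x) =
      \sum_(mu < 3) dx T ga (cpt v mu) (c, x) * dx T be (cpt v mu) (c, x).
    by apply: eq_bigr => mu _; exact: mulrC.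
  exact: (etrans (big_split _ _ _ _ _)
    (etrans (f_equal2 +%R As Bs) (esym (big_split _ _ _ _ _)))).
have factor (k a b d e : R) : (0 * a + k * b) * d + k * a * e = k * (b * d + a * e).
  by ring.
rewrite -[RHS](mul0r t); congr (_ * _).
apply: (etrans _ (levi_civita_contract_sym S al Ssym)).
apply: eq_bigr => be _; apply: eq_bigr => ga _.
rewrite mulr_sumr; apply: eq_bigr => mu _; exact: factor.
Qed.

End Solution.

Theorem proposition2p8 (R : realType) (sigma T : R) (q : R -> R)
    (rho0 : 'rV[R]_3 -> R) (v0 : 'rV[R]_3 -> 'rV[R]_3)
    (v : R * 'rV[R]_3 -> 'rV[R]_3) (rho : R * 'rV[R]_3 -> R)
    (eta : R * 'rV[R]_3 -> 'rV[R]_3)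
    (hsigma : 0 < sigma) (hT : 0 < T)
    (hdata : initial_data rho0 v0)
    (hq : equation_of_state q rho0)
    (hsol : smooth_solution T sigma q rho0 v0 v rho eta) :
  forall (t : R) (x : 'rV[R]_3), 0 <= t < T -> Omega x ->
  forall al : 'I_3,
    \sum_(be < 3) \sum_(ga < 3) \sum_(mu < 3)
      levi_civita al be ga * dx T be (cpt v mu) (t, x)
        * dx T ga (cpt eta mu) (t, x)
    = curl v0 x al.
Proof.
move=> t x tT Ox al.
rewrite (vorticity_conserved _ _ _ _ _ _ _ _ hT hq hsol _ _ _ tT Ox) /curl.
apply: eq_bigr => be _; apply: eq_bigr => ga _.
have dv0 : dx T be (cpt v ga) (0, x) = deriv_in Omega (ebase be) (cpt v0 ga) x.
  have nO := near_Omega_line (ebase be) x Ox.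
  rewrite /dx /deriv_in (incr_in_space _ _ _ (cyl_init T hT x Ox))
    (incr_in_near _ _ _ nO).
  suff -> : diffq (cpt v ga) (ebase_st (Some be)) (0, x) @ 0^' =
    diffq (cpt v0 ga) (ebase be) x @ 0^' by [].
  have eqd : \forall h \near (0 : R)^',
      diffq (cpt v ga) (ebase_st (Some be)) (0, x) h = diffq (cpt v0 ga) (ebase be) x h.
    apply: filterS (nbhs_dnbhs nO) => h Oh.
    by rewrite /diffq st_spaceE /cpt !(sol_v_init hsol).
  apply/seteqP; split; apply: near_eq_cvg => //.
  by apply: filterS eqd => h ->.
rewrite (bigD1 ga) //= [X in _ + X]big1 => [|mu /negPf muga].
  rewrite (grad_eta_init _ _ _ _ _ _ _ _ hT hsol) // !mxE !eqxx mulr1 addr0 dv0.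
  reflexivity.
by rewrite (grad_eta_init _ _ _ _ _ _ _ _ hT hsol) // !mxE muga mulr0.
Qed.
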